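(* Let $\phi = \frac{1+\sqrt{5}}{2}$ be the golden ratio. Given an arbitrary pentagon whose vertices are denoted as $A, B, C, D, E$, the pentagon with vertices \begin{align*} A' &= H_{\phi}(B,C,D,E), \\ B' &= H_{\phi}(C,D,E,A), \\ C' &= H_{\phi}(D,E,A,B), \\ D' &= H_{\phi}(E,A,B,C), \\ E' &= H_{\phi}(A,B,C,D) \end{align*} is projectively regular. In other words, the natural polygon iteration $H_{\phi}$ on pentagons is immediately regularizing.
   Context: The setting is planar projective geometry: the group of projective transformations acting on the real projective plane $\mathbb{R}P^2$, which extends the plane $\mathbb{R}^2$. A pentagon is a polygon with $5$ vertices, listed in cyclic order; it is not required to be convex or simple. The construction $H_\lambda$: for points $X, Y$ let $XY$ denote the line through them. Given $4$ points $A, B, C, D$, construct the points $P = AC \cap BD$, $Q = AB \cap CD$ and $H = BC \cap PQ$. Parametrize the line $PQ$ by using a projective transformation to map it to the projective line $\mathbb{R}P^1 = \mathbb{R} \cup \{\infty\}$ so that $P, H, Q$ correspond to $0, 1, \infty$, respectively. For $\lambda \in \mathbb{R}P^1$, $H_\lambda(A,B,C,D)$ denotes the point of the line $PQ$ that is the preimage of $\lambda$. Applying $H_\lambda$ cyclically to consecutive quadruples of vertices of a polygon gives a polygon iteration (a construction producing a new polygon from a given one, viewed as a self-map on polygons), also denoted $H_\lambda$. A polygon iteration is natural (in projective geometry) if it commutes with every projective transformation. A polygon is projectively regular if it can be carried by a projective transformation to a regular polygon in the Euclidean sense. A polygon iteration on $n$-gons is immediately regularizing (in projective geometry) if it transforms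 an arbitrary $n$-gon to a projectively regular $n$-gon.
   Formalization: ''Arbitrary pentagon'' is read as: any five points whose image vertices exist with no three collinear; such pentagons are shown to form an open dense set. For the regular pentagram all five image vertices coincide, so the unrestricted claim fails. *)

(* Defs.v *)
From HB Require Import structures.
From mathcomp Require Import all_boot all_order all_algebra.
From mathcomp Require Import all_classical all_reals all_analysis.

Set Implicit Arguments.
Unset Strict Implicit.
Unset Printing Implicit Defensive.

Import Order.TTheory GRing.Theory Num.Theory.
Import numFieldNormedType.Exports.

Local Open Scope classical_set_scope.
Local Open Scope ring_scope.

(* The real projective plane is modelled by the lattice of linear subspaces of
   R^3: points are the subspaces of dimension 1, the line through two distinct
   points is their sum, and the common point of two distinct lines is their
   intersection. *)
Notation subspace3 R := {vspace 'rV[R : realType]_3}.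

Definition is_point (R : realType) (X : subspace3 R) : Prop := \dim X = 1%N.

(* A projective transformation is the map f @: _ induced by an invertible
   linear map f. *)
Definition is_projective (R : realType) (f : 'End('rV[R]_3)) : Prop :=
  lker f = 0%VS.

Definition plane_point (R : realType) (v : R * R) : subspace3 R :=
  <[(\row_(j < 3) nth 0 [:: v.1; v.2; 1] j)%R]>%VS.

(* The projective line R \cup {oo}, as the set of lines of R^2; None is oo. *)
Definition rp1_point (R : realType) (l : option R) : {vspace 'rV[R]_2} :=
  if l is Some t then <[(\row_(j < 2) nth 0 [:: t; 1] j)%R]>%VS
  else <[(\row_(j < 2) nth 0 [:: 1; 0] j)%R]>%VS.

Section Construction.
Variables (R : realType) (A B C D : subspace3 R).

Definition ptP : subspace3 R := ((A + C) :&: (B + D))%VS.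
Definition ptQ : subspace3 R := ((A + B) :&: (C + D))%VS.
Definition ptH : subspace3 R := ((B + C) :&: (ptP + ptQ))%VS.

(* Every line is drawn through two distinct points, every intersection is taken
   between two distinct lines, and P, H, Q are distinct. *)
Definition H_defined : Prop :=
  [/\ [/\ is_point A, is_point B, is_point C & is_point D],
      [/\ A <> C, B <> D & (A + C <> B + D)%VS],
      [/\ A <> B, C <> D & (A + B <> C + D)%VS],
      [/\ B <> C, ptP <> ptQ & (B + C <> ptP + ptQ)%VS] &
      ptP <> ptH /\ ptH <> ptQ].

(* X is the point of parameter l on the line PQ; the parametrization of the
   line is induced by a linear map R^3 -> R^2 that is injective on it. *)
Definition is_Hpoint (l : option R) (X : subspace3 R) : Prop :=
  [/\ H_defined, (X <= ptP + ptQ)%VS &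
      exists f : 'Hom('rV[R]_3, 'rV[R]_2),
        [/\ ((ptP + ptQ) :&: lker f = 0)%VS,
            (f @: ptP)%VS = rp1_point (Some 0),
            (f @: ptH)%VS = rp1_point (Some 1),
            (f @: ptQ)%VS = rp1_point None &
            (f @: X)%VS = rp1_point l]].

(* The value is the zero subspace, which is not a point, when the construction
   is not defined. *)
Definition H_ (l : option R) : subspace3 R := xget 0%VS (is_Hpoint l).

End Construction.

Definition polygon (R : realType) (n : nat) := 'I_n -> subspace3 R.

Definition H_iteration (R : realType) (n : nat) (l : option R)
    (p : polygon R n) : polygon R n :=
  fun i => let s k := p (iter k (@ordS n) i) in
    H_ (s 1%N) (s 2%N) (s 3%N) (s 4%N) l.

(* All vertices are points, and no three of them are collinear. *)
Definition general_position (R : realType) (n : nat) (p : polygon R n) : Prop :=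
  (forall i, is_point (p i)) /\
  (forall i j k, i != j -> j != k -> i != k ->
     \dim (p i + p j + p k)%VS = 3%N).

(* The vertices are equally spaced on a circle, in cyclic order; the sign gives
   the orientation. *)
Definition regular_polygon (R : realType) (n : nat) (v : 'I_n -> R * R) : Prop :=
  exists (c : R * R) (r t : R) (s : bool), 0 < r /\
    forall k : 'I_n,
      let a := t + (-1) ^+ s * (2 * pi * k%:R / n%:R) in
      v k = (c.1 + r * cos a, c.2 + r * sin a).

Definition projectively_regular (R : realType) (n : nat) (p : polygon R n) :
    Prop :=
  exists (f : 'End('rV[R]_3)) (v : 'I_n -> R * R),
    [/\ is_projective f, regular_polygon v &
        forall i, (f @: p i)%VS = plane_point (v i)].

Definition natural_iteration (R : realType) (n : nat)
    (T : polygon R n -> polygon R n) : Prop :=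
  forall f : 'End('rV[R]_3), is_projective f ->
  forall p : polygon R n, (forall i, is_point (p i)) ->
  forall i, T (fun j => (f @: p j)%VS) i = (f @: T p i)%VS.

(* The polygon whose vertices have the rows of M as homogeneous coordinates. *)
Definition polygon_of_mx (R : realType) (n : nat) (M : 'M[R]_(n, 3)) :
    polygon R n :=
  fun i => <[row i M]>%VS.

(* A polygon iteration is a partial map: p is in its domain when T p is a polygon
   in general position.  An arbitrary polygon is a generic one: an open dense
   set of polygons is contained in the domain, and each polygon in the domain
   has a projectively regular image.  Some restriction is necessary: there are
   pentagons in general position, for instance the regular pentagram, from which
   the golden ratio construction yields collinear or coincident vertices. *)
Definition immediately_regularizing (R : realType) (n : nat)
    (T : polygon R n -> polygon R n) : Prop :=
  let dom := [set M : 'M[R]_(n, 3) | general_position (T (polygon_of_mx M))] in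
  [/\ open dom, dense dom &
      forall p : polygon R n, (forall i, is_point (p i)) ->
        general_position (T p) -> projectively_regular (T p)].

Definition golden_ratio (R : realType) : R := (1 + Num.sqrt 5) / 2.

(* Main.v *)
Require Import Defs.
From HB Require Import structures.
From mathcomp Require Import all_boot all_order all_algebra.
From mathcomp Require Import all_classical all_reals all_analysis.
From mathcomp Require Import ring lra.
Import Order.TTheory GRing.Theory Num.Theory.
Import numFieldNormedType.Exports.
Local Open Scope ring_scope.
Set Implicit Arguments.
Unset Strict Implicit.
Unset Printing Implicit Defensive.

(** Represent the vertices of a pentagon by vectors v_0, ..., v_4 of R^3 and
    write [u v w] for the determinant of three vectors.  In the basis a, b, c,
    Cramer's rule gives the coordinates of d, hence those of the points P, Q
    and H of the construction, and the point of parameter l on the line PQ is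
    spanned by
      (1 - l) [b c d] a + l [a c d] b + [a b d] c            ([hvec]),
    which is a polynomial in the coordinates of the four vectors.

    Let q_i span the image of vertex i for l = phi.  Everything rests on
    two polynomial identities, valid because phi^2 = phi + 1
    ([bracket_consecutive], [bracket_nonconsecutive]): up to constants, the
    determinant of three of the q_i is the product k_m k_n of the weights of
    the two remaining vertices,
      [q_i q_(i+1) q_(i+2)] = (3 - phi) k_(i+3) k_(i+4),
      [q_i q_(i+1) q_(i+3)] = phi (3 - phi) k_(i+2) k_(i+4).
    Rescaling q_i to k_i q_i therefore makes all ten determinants equal to one
    of two values, in the ratio phi, according to whether the three vertices
    are consecutive.  By Cramer's rule the rescaled vectors satisfy
      u_3 = u_0 - phi u_1 + phi u_2,   u_4 = phi u_0 - phi u_1 + u_2,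
    and so do the vectors (cos (k theta), sin (k theta), 1) of a regular
    pentagon, since phi = 2 cos theta + 1 for theta = 2 pi / 5.  The linear map
    that matches the first three vectors of the two families matches all five,
    so the image is projectively regular ([H_iteration_regular]).

    The identities also describe the domain: the image is in general position
    exactly when the five determinants of consecutive vertices and the five
    weights are nonzero.  The domain is thus the nonvanishing set of one
    polynomial; it contains the regular pentagon, hence is open and dense.
    Naturality follows from the covariance of determinants, once H is known to
    be given by [hvec]. *)

(** * Brackets of homogeneous coordinate vectors *)

Section Bracket.
Variable K : comNzRingType.
Implicit Types (a b c d e u v w : 'rV[K]_3) (l f : K) (F : 'M[K]_3).

(** The determinant is expanded so that polynomial identities between brackets
    become ring identities between coordinates. *)
Definition bracket u v w : K :=
  u 0 0 * (v 0 1 * w 0 2 - v 0 2 * w 0 1)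
  - u 0 1 * (v 0 0 * w 0 2 - v 0 2 * w 0 0)
  + u 0 2 * (v 0 0 * w 0 1 - v 0 1 * w 0 0).

Definition rows3 u v w : 'M[K]_3 := \matrix_(i, j) (nth 0 [:: u; v; w] i) 0 j.

Lemma ord3P (P : 'I_3 -> Prop) : P 0 -> P 1 -> P 2 -> forall i, P i.
Proof.
move=> P0 P1 P2 [[|[|[|//]]] lt_i3].
- by rewrite (_ : Ordinal _ = 0) //; apply/val_inj.
- by rewrite (_ : Ordinal _ = 1) //; apply/val_inj.
- by rewrite (_ : Ordinal _ = 2) //; apply/val_inj.
Qed.

Lemma row3P u v : u 0 0 = v 0 0 -> u 0 1 = v 0 1 -> u 0 2 = v 0 2 -> u = v.
Proof.
move=> e0 e1 e2; apply/rowP.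
by apply: (@ord3P (fun j => u 0 j = v 0 j)).
Qed.

Lemma sum3E (V : nmodType) (F : 'I_3 -> V) : \sum_i F i = F 0 + F 1 + F 2.
Proof.
rewrite !big_ord_recl big_ord0 addr0 addrA.
by congr (_ + F _ + F _); apply/val_inj.
Qed.

Lemma det_rows3 u v w : \det (rows3 u v w) = bracket u v w.
Proof.
rewrite (expand_det_row _ 0) sum3E /cofactor.
rewrite !(expand_det_row _ (0 : 'I_2)) !big_ord_recl !big_ord0 /cofactor.
rewrite !det_mx11 !mxE /= /bracket /bump /=.
have e1 : lift (0 : 'I_3) (0 : 'I_2) = 1 by apply/val_inj.
have e2 : lift (0 : 'I_3) (lift (0 : 'I_2) (0 : 'I_1)) = 2 by apply/val_inj.
have e3 : lift (1 : 'I_3) (0 : 'I_2) = 0 by apply/val_inj.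
have e4 : lift (1 : 'I_3) (lift (0 : 'I_2) (0 : 'I_1)) = 2 by apply/val_inj.
have e5 : lift (2 : 'I_3) (0 : 'I_2) = 0 by apply/val_inj.
have e6 : lift (2 : 'I_3) (lift (0 : 'I_2) (0 : 'I_1)) = 1 by apply/val_inj.
have e7 : lift (lift (0 : 'I_2) (0 : 'I_1)) (0 : 'I_1) = 0 by apply/val_inj.
rewrite /= ?(e1, e2, e3, e4, e5, e6, e7) /=.
ring.
Qed.

Lemma bracket_cycle u v w : bracket v w u = bracket u v w.
Proof. by rewrite /bracket; ring. Qed.

Lemma bracket_swap u v w : bracket u v w = - bracket u w v.
Proof. by rewrite /bracket; ring. Qed.

Lemma bracket_mulmx u v w F :
  bracket (u *m F) (v *m F) (w *m F) = bracket u v w * \det F.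
Proof.
rewrite -!det_rows3 -det_mulmx; congr (\det _).
apply/matrixP => i j; rewrite !mxE.
by elim/ord3P: i; rewrite /= !mxE; apply: eq_bigr => k _; rewrite !mxE.
Qed.

Lemma cramer a b c d :
  bracket a b c *: d =
  bracket d b c *: a + bracket a d c *: b + bracket a b d *: c.
Proof. by apply: row3P; rewrite !mxE /bracket; ring. Qed.

(** Homogeneous coordinates of the point of parameter [l] on the diagonal PQ of
    the quadrangle [a], [b], [c], [d]; [H_line] justifies the formula. *)
Definition hvec l a b c d :=
  ((1 - l) * bracket b c d) *: a + (l * bracket a c d) *: b
  + bracket a b d *: c.

Lemma hvec_mulmx l a b c d F :
  hvec l (a *m F) (b *m F) (c *m F) (d *m F) = \det F *: (hvec l a b c d *m F).
Proof.
rewrite /hvec !bracket_mulmx !mulmxDl -!scalemxAl !scalerDr !scalerA.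
by congr (_ *: _ + _ *: _ + _ *: _); ring.
Qed.

(** This vanishes when the lines from [c] to [a], [b], [d], [e] have the cross
    ratio [c a d][c b e] / [c a e][c b d] = - 1 / f; for the golden ratio, that
    is the cross ratio at a vertex of the regular pentagram. *)
Definition vertex_weight f a b c d e :=
  f * (bracket c a d * bracket c b e) + bracket c b d * bracket c a e.

(** Both sides have degree 12 in the coordinates.  The two weights are those at
    [d] and [e], the vertices whose images do not appear on the left. *)
Lemma bracket_consecutive f a b c d e : f ^+ 2 = f + 1 ->
  bracket (hvec f b c d e) (hvec f c d e a) (hvec f d e a b) =
  (3 - f) * (vertex_weight f b c d e a * vertex_weight f c d e a b).
Proof. by move=> f2; rewrite /vertex_weight /hvec /bracket !mxE; ring: f2. Qed.

(** Here the vertices whose images do not appear on the left are [c] and [e]. *)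
Lemma bracket_nonconsecutive f a b c d e : f ^+ 2 = f + 1 ->
  bracket (hvec f b c d e) (hvec f c d e a) (hvec f e a b c) =
  f * (3 - f) * (vertex_weight f a b c d e * vertex_weight f c d e a b).
Proof. by move=> f2; rewrite /vertex_weight /hvec /bracket !mxE; ring: f2. Qed.

End Bracket.

(** * Points and lines as subspaces *)

Section Lines.
Variable K : fieldType.
Implicit Types (u v w x y : 'rV[K]_3) (L : {vspace 'rV[K]_3}).

Lemma bracket_eq0P u v w :
  reflect (exists2 k : 'rV[K]_3,
             k != 0 & k 0 0 *: u + k 0 1 *: v + k 0 2 *: w = 0)
          (bracket u v w == 0).
Proof.
have rowsE i : row i (rows3 u v w) = nth 0 [:: u; v; w] i.
  by apply/rowP => j; rewrite !mxE.
rewrite -det_rows3; apply: (iffP det0P) => -[k k_neq0 k0]; exists k => //.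
  by move: k0; rewrite mulmx_sum_row sum3E !rowsE.
by rewrite mulmx_sum_row sum3E !rowsE.
Qed.

Lemma free3E u v w : free [:: u; v; w] = (bracket u v w != 0).
Proof.
apply/idP/idP => [/(@freeP _ _ _ [tuple u; v; w]) fr|nk].
  apply/negP => /bracket_eq0P[k k_neq0 k0]; case/eqP: k_neq0.
  have kE i : k 0 i = 0 by apply: (fr (fun i => k 0 i)); rewrite sum3E.
  by apply/rowP => i; rewrite kE mxE.
apply/(@freeP _ _ _ [tuple u; v; w]) => k k0 i.
apply/eqP/negP => /negP ki; case/bracket_eq0P: nk.
exists (\row_j k j); last by move: k0; rewrite sum3E !mxE.
by apply: contra_neq ki => /rowP/(_ i); rewrite !mxE.
Qed.

Lemma dim_span3 u v w :
  \dim (<[u]> + <[v]> + <[w]>) = 3%N <-> bracket u v w != 0.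
Proof.
rewrite -free3E /free !span_cons span_nil addv0 addvA /=.
by split=> [->|/eqP].
Qed.

Lemma bracket_neq0_line_neq u v w :
  bracket u v w != 0 -> <[u]>%VS <> <[v]>%VS.
Proof.
move=> /dim_span3 dim3 uv; move: dim3; rewrite uv addvv.
have := (dimv_leqif_sup (addvSl <[v]> <[w]>)).1.
have := dimv_add_leqif <[v]> <[w]>; rewrite !dim_vline => -[+ _] => + _.
by case: (v != 0); case: (w != 0) => + E; rewrite E.
Qed.

Lemma bracket_neq0 u v w :
  bracket u v w != 0 -> [/\ u != 0, v != 0 & w != 0].
Proof.
by move=> uvw; split; apply: contra_neq uvw => ->; rewrite /bracket !mxE; ring.
Qed.

Lemma dim_join u v : u != 0 -> v != 0 -> <[u]>%VS <> <[v]>%VS ->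
  \dim (<[u]> + <[v]>) = 2%N.
Proof.
move=> u0 v0 uv; apply: anti_leq; apply/andP; split.
  have := (dimv_add_leqif <[u]> <[v]>).1.
  by rewrite !dim_vline u0 v0.
rewrite ltnNge; apply/negP => le1; apply: uv.
have uE : <[u]>%VS = (<[u]> + <[v]>)%VS.
  by apply/eqP; rewrite eqEdim addvSl dim_vline u0.
rewrite [LHS]uE; apply/esym/eqP.
by rewrite eqEdim addvSr dim_vline v0.
Qed.

Lemma mem_join_collinear u v w : u != 0 -> v != 0 -> <[u]>%VS <> <[v]>%VS ->
  bracket u v w = 0 -> w \in (<[u]> + <[v]>)%VS.
Proof.
move=> u0 v0 uv uvw0; have d2 := dim_join u0 v0 uv.
have : \dim (<[u]> + <[v]> + <[w]>) != 3%N.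
  by apply/eqP => /dim_span3; rewrite uvw0 eqxx.
have := (dimv_leqif_sup (addvSl (<[u]> + <[v]>) <[w]>)).
have := (dimv_add_leqif (<[u]> + <[v]>) <[w]>).1.
rewrite d2 dim_vline => le3 [le2 eq2] ne3.
have : (<[u]> + <[v]> + <[w]> <= <[u]> + <[v]>)%VS.
  rewrite -eq2 eqn_leq le2 /= -ltnS ltn_neqAle ne3 /=.
  by apply: leq_trans le3 _; case: (w != 0).
by rewrite subv_add => /andP[_]; rewrite -memvE.
Qed.

(** The intersection is a proper subspace of a plane, so one nonzero common
    vector determines it. *)
Lemma meet_eq L L' u : \dim L = 2%N -> \dim L' = 2%N -> L <> L' ->
  u != 0 -> u \in L -> u \in L' -> (L :&: L')%VS = <[u]>%VS.
Proof.
move=> L2 L'2 LL' u0 uL uL'; apply/eqP; rewrite eq_sym eqEdim.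
rewrite subv_cap -!memvE uL uL' /= dim_vline u0 leqNgt; apply/negP => gt1.
apply: LL'; have LE : (L :&: L')%VS = L.
  by apply/eqP; rewrite eqEdim capvSl L2.
by apply/eqP; rewrite eqEdim L2 L'2 leqnn andbT -LE capvSr.
Qed.

Lemma meet_at_vertex L u v : \dim L = 2%N -> u != 0 -> v != 0 ->
  <[u]>%VS <> <[v]>%VS -> u \in L -> L <> (<[u]> + <[v]>)%VS ->
  (L :&: (<[u]> + <[v]>))%VS = <[u]>%VS.
Proof.
move=> L2 u0 v0 uv uL Luv; apply: meet_eq => //; first exact: dim_join.
by rewrite memvE addvSl.
Qed.

Lemma bracket_joins_neq u v w x y : bracket u v w != 0 ->
  u != 0 -> v != 0 -> <[u]>%VS <> <[v]>%VS ->
  w \in (<[x]> + <[y]>)%VS -> (<[u]> + <[v]>)%VS <> (<[x]> + <[y]>)%VS.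
Proof.
move=> uvw u0 v0 uv wxy E; move: wxy; rewrite -E memvE.
move=> /addv_idPl E'; move/dim_span3: uvw; rewrite E'.
by rewrite dim_join.
Qed.

Lemma vline_scale (vT : vectType K) (k : K) (v : vT) :
  k != 0 -> <[k *: v]>%VS = <[v]>%VS.
Proof.
move=> k0; apply/eqP.
rewrite eqEdim -memvE memvZ ?memv_line // !dim_vline scaler_eq0 negb_or k0.
exact: leqnn.
Qed.

Lemma limg_inj (aT rT : vectType K) (f : 'Hom(aT, rT)) (U V W : {vspace aT}) :
  (W :&: lker f)%VS = 0%VS -> (U <= W)%VS -> (V <= W)%VS ->
  (f @: U)%VS = (f @: V)%VS -> U = V.
Proof.
move=> kf.
have sub (U' V' : {vspace aT}) : (U' <= W)%VS -> (V' <= W)%VS ->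
    (f @: U')%VS = (f @: V')%VS -> (U' <= V')%VS.
  move=> U'W V'W fUV; apply/subvP => u uU.
  have : f u \in (f @: V')%VS by rewrite -fUV memv_img.
  case/memv_imgP => v vV fuv.
  suff /eqP : u - v == 0 by move=> /subr0_eq ->.
  rewrite -memv0 -kf memv_cap memvB /= ?(subvP U'W u uU) ?(subvP V'W v vV) //.
  by rewrite memv_ker linearB /= fuv subrr.
by move=> UW VW fUV; apply/eqP; rewrite eqEsubv (sub U V) // (sub V U).
Qed.

End Lines.

(** * The construction in homogeneous coordinates *)

Section Construction.
Variable R : realType.
Implicit Types (a b c d : 'rV[R]_3) (l : R).

Lemma pointE (X : subspace3 R) : is_point X -> X = <[vpick X]>%VS.
Proof.
move=> X1; apply/eqP; rewrite eq_sym eqEdim -memvE memv_pick dim_vline X1.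
by rewrite vpick0 -dimv_eq0 X1.
Qed.

(** If A, B, C are collinear, then P = B and Q = C, so that PQ is the line BC;
    if B, C, D are collinear, then P = C and Q = B.  If A = D, then P = Q. *)
Lemma H_defined_bracket a b c d :
  H_defined <[a]> <[b]> <[c]> <[d]> ->
  [/\ bracket a b c != 0, bracket b c d != 0 & <[a]>%VS <> <[d]>%VS].
Proof.
case; rewrite /is_point !dim_vline.
case=> /eqP; rewrite eqb1 => a0 /eqP; rewrite eqb1 => b0.
move=> /eqP; rewrite eqb1 => c0 /eqP; rewrite eqb1 => d0.
case=> ac bd acbd [ab cd abcd] [bc PQ bcPQ] _.
have dab := dim_join a0 b0 ab; have dac := dim_join a0 c0 ac.
have dcd := dim_join c0 d0 cd; have dbd := dim_join b0 d0 bd.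
split.
- apply/eqP => abc0; apply: bcPQ.
  have b_ac : b \in (<[a]> + <[c]>)%VS.
    apply: mem_join_collinear => //.
    by rewrite -[RHS]oppr0 -abc0 /bracket; ring.
  have c_ab : c \in (<[a]> + <[b]>)%VS by apply: mem_join_collinear.
  by rewrite /ptP /ptQ !meet_at_vertex.
- apply/eqP => bcd0; apply: bcPQ.
  have c_bd : c \in (<[b]> + <[d]>)%VS.
    apply: mem_join_collinear => //.
    by rewrite -[RHS]oppr0 -bcd0 /bracket; ring.
  have b_cd : b \in (<[c]> + <[d]>)%VS.
    by apply: mem_join_collinear => //; rewrite -bcd0 /bracket; ring.
  have -> : ptP <[a]> <[b]> <[c]> <[d]> = <[c]>%VS.
    rewrite /ptP capvC [(<[a]> + _)%VS]addvC.
    apply: meet_at_vertex => //; first exact/nesym.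
    by rewrite [X in _ <> X]addvC; apply/nesym.
  have -> : ptQ <[a]> <[b]> <[c]> <[d]> = <[b]>%VS.
    rewrite /ptQ capvC [(<[a]> + _)%VS]addvC.
    apply: meet_at_vertex => //; first exact/nesym.
    by rewrite [X in _ <> X]addvC; apply/nesym.
  by rewrite addvC.
- move=> ad; apply: PQ; rewrite /ptP /ptQ -ad capvC.
  by rewrite [(<[b]> + _)%VS]addvC [(<[c]> + _)%VS]addvC.
Qed.

(** Cramer's rule for [d] in the basis [a], [b], [c], with one of the three
    terms moved to the side of [d]: this exhibits a vector on both lines that
    define the point P, and likewise for Q. *)
Definition vecP a b c d := bracket d b c *: a + bracket a b d *: c.
Definition vecQ a b c d := bracket d b c *: a + bracket a d c *: b.

Lemma hvec_vecPQ l a b c d :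
  hvec l a b c d = vecP a b c d - l *: vecQ a b c d.
Proof.
by apply: row3P; rewrite /hvec /vecP /vecQ !mxE /bracket; ring.
Qed.

Lemma vecP_side a b c d :
  vecP a b c d = bracket a b c *: d - bracket a d c *: b.
Proof. by rewrite (cramer a b c d) /vecP; apply: row3P; rewrite !mxE; ring. Qed.

Lemma vecQ_side a b c d :
  vecQ a b c d = bracket a b c *: d - bracket a b d *: c.
Proof. by rewrite (cramer a b c d) /vecQ; apply: row3P; rewrite !mxE; ring. Qed.

(** A vector that lies on both BC and PQ, hence spans the point H. *)
Lemma vecPB a b c d :
  vecP a b c d - vecQ a b c d = bracket a b d *: c - bracket a d c *: b.
Proof. by apply: row3P; rewrite /vecP /vecQ !mxE; ring. Qed.

(** Otherwise both [a b d] and [a d c] vanish, and [d] is a multiple of [a]. *)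
Lemma vecPQ_independent a b c d :
  bracket a b c != 0 -> bracket b c d != 0 -> <[a]>%VS <> <[d]>%VS ->
  exists w, bracket (vecP a b c d) (vecQ a b c d) w != 0.
Proof.
move=> abc bcd ad; have dbc : bracket d b c != 0 by rewrite -bracket_cycle.
have [abd0|abd] := eqVneq (bracket a b d) 0; last first.
  exists b; suff -> : bracket (vecP a b c d) (vecQ a b c d) b =
      bracket a b d * bracket d b c * bracket a b c.
    by rewrite !mulf_neq0.
  by rewrite /vecP /vecQ /bracket !mxE; ring.
have [adc0|adc] := eqVneq (bracket a d c) 0; last first.
  exists c; suff -> : bracket (vecP a b c d) (vecQ a b c d) c =
      bracket a d c * bracket d b c * bracket a b c.
    by rewrite !mulf_neq0.
  by rewrite /vecP /vecQ /bracket !mxE; ring.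
case: ad; rewrite -(vline_scale d abc) (cramer a b c d) abd0 adc0.
by rewrite !scale0r !addr0 vline_scale.
Qed.

Section Defined.
Variables a b c d : 'rV[R]_3.
Hypotheses (abc : bracket a b c != 0) (bcd : bracket b c d != 0).
Hypothesis ad : <[a]>%VS <> <[d]>%VS.
Let p := vecP a b c d.
Let q := vecQ a b c d.

Let memL (u v : 'rV[R]_3) : u \in (<[u]> + <[v]>)%VS.
Proof. by rewrite memvE addvSl. Qed.
Let memR (u v : 'rV[R]_3) : v \in (<[u]> + <[v]>)%VS.
Proof. by rewrite memvE addvSr. Qed.

Let nzs : [/\ a != 0, b != 0, c != 0 & d != 0].
Proof.
by have [? ? ?] := bracket_neq0 abc; have [_ _ ?] := bracket_neq0 bcd.
Qed.

Let ab : <[a]>%VS <> <[b]>%VS. Proof. exact: bracket_neq0_line_neq abc. Qed.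
Let bc : <[b]>%VS <> <[c]>%VS.
Proof. by apply: (@bracket_neq0_line_neq _ b c a); rewrite bracket_cycle. Qed.
Let ac : <[a]>%VS <> <[c]>%VS.
Proof.
by apply/nesym/(@bracket_neq0_line_neq _ c a b); rewrite -bracket_cycle.
Qed.
Let cd : <[c]>%VS <> <[d]>%VS.
Proof. by apply: (@bracket_neq0_line_neq _ c d b); rewrite bracket_cycle. Qed.
Let bd : <[b]>%VS <> <[d]>%VS.
Proof.
by apply/nesym/(@bracket_neq0_line_neq _ d b c); rewrite -bracket_cycle.
Qed.

Let acbd : (<[a]> + <[c]>)%VS <> (<[b]> + <[d]>)%VS.
Proof.
have [? ? ? ?] := nzs; apply: (bracket_joins_neq (w := b)) => //.
by have := abc; rewrite -oppr_eq0; congr (_ != 0); rewrite /bracket; ring.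
Qed.

Let abcd : (<[a]> + <[b]>)%VS <> (<[c]> + <[d]>)%VS.
Proof. by have [? ? ? ?] := nzs; apply: (bracket_joins_neq (w := c)). Qed.

Let pqw : exists w, bracket p q w != 0.
Proof. exact: vecPQ_independent. Qed.

Let pq_neq0 : p != 0 /\ q != 0.
Proof. by case: pqw => w /bracket_neq0[]. Qed.

Let pBq_neq0 : p - q != 0.
Proof.
case: pqw => w; apply: contra_neq => /subr0_eq ->.
by rewrite /bracket; ring.
Qed.

Let pq_line : <[p]>%VS <> <[q]>%VS.
Proof. by case: pqw => w /bracket_neq0_line_neq. Qed.

Lemma ptP_line : ptP <[a]> <[b]> <[c]> <[d]> = <[p]>%VS.
Proof.
have [? ? ? ?] := nzs; have [p0 _] := pq_neq0.
apply: meet_eq; rewrite ?dim_join // /p.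
  by rewrite /vecP memvD // memvZ // memL.
by rewrite vecP_side memvB // memvZ // memR.
Qed.

Lemma ptQ_line : ptQ <[a]> <[b]> <[c]> <[d]> = <[q]>%VS.
Proof.
have [? ? ? ?] := nzs; have [_ q0] := pq_neq0.
apply: meet_eq; rewrite ?dim_join // /q.
  by rewrite /vecQ memvD // memvZ // memL.
by rewrite vecQ_side memvB // memvZ // memR.
Qed.

Let bcpq : (<[b]> + <[c]>)%VS <> (<[p]> + <[q]>)%VS.
Proof.
have [? ? ? ?] := nzs; apply: (bracket_joins_neq (w := p)) => //.
suff -> : bracket b c p = bracket b c d * bracket a b c by rewrite mulf_neq0.
by rewrite /p /vecP /bracket !mxE; ring.
Qed.

Lemma ptH_line : ptH <[a]> <[b]> <[c]> <[d]> = <[p - q]>%VS.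
Proof.
have [? ? ? ?] := nzs; have [? ?] := pq_neq0.
rewrite /ptH ptP_line ptQ_line; apply: meet_eq; rewrite ?dim_join //.
  by rewrite /p /q vecPB memvB // memvZ.
by rewrite memvB.
Qed.

Lemma H_definedT : H_defined <[a]> <[b]> <[c]> <[d]>.
Proof.
have [a0 b0 c0 d0] := nzs.
split=> //; rewrite ?ptP_line ?ptQ_line ?ptH_line //.
  by rewrite /is_point !dim_vline a0 b0 c0 d0.
case: pqw => w pqw0; split.
  apply: (@bracket_neq0_line_neq _ _ _ w).
  have := pqw0; rewrite -oppr_eq0; congr (_ != 0).
  by rewrite /bracket !mxE; ring.
apply: (@bracket_neq0_line_neq _ _ _ w).
have := pqw0; congr (_ != 0).
by rewrite /bracket !mxE; ring.
Qed.

Let row2P (u v : 'rV[R]_2) : u 0 0 = v 0 0 -> u 0 1 = v 0 1 -> u = v.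
Proof.
move=> e0 e1; apply/rowP => -[[|[|//]] lt_i2].
  by rewrite (_ : Ordinal _ = 0) //; apply/val_inj.
by rewrite (_ : Ordinal _ = 1) //; apply/val_inj.
Qed.

(** With [w] independent of [p] and [q], the coordinates along [p] and [q] are
    brackets with [w]; they send [p], [p - q], [q] to multiples of (0, 1),
    (1, 1), (1, 0), so [p - l *: q] goes to a multiple of (l, 1). *)
Lemma is_Hpoint_hvec l :
  is_Hpoint <[a]> <[b]> <[c]> <[d]> (Some l) <[hvec l a b c d]>.
Proof.
split; rewrite ?ptP_line ?ptQ_line ?ptH_line.
- exact: H_definedT.
- by rewrite hvec_vecPQ -memvE memvB // memvZ.
case: pqw => w pqw0.
pose g (x : 'rV[R]_3) : 'rV[R]_2 :=
  \row_j nth 0 [:: - bracket p x w; bracket x q w] j.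
have g_lin : linear g.
  by move=> k x y; apply: row2P; rewrite !mxE /= /bracket !mxE; ring.
pose gL := GRing.isLinear.Build _ _ _ _ g g_lin.
pose G : {linear 'rV[R]_3 -> 'rV[R]_2} := HB.pack g gL.
have GE x : linfun G x = g x by rewrite lfunE.
have gpq k m :
    g (k *: p + m *: q) = bracket p q w *: \row_j nth 0 [:: - m; k] j.
  by apply: row2P; rewrite !mxE /= /bracket !mxE; ring.
have lineE x k m : x = k *: p + m *: q ->
    (linfun G @: <[x]>)%VS = <[(\row_(j < 2) nth 0 [:: - m; k] j)%R]>%VS.
  by move=> ->; rewrite limg_line GE gpq vline_scale.
exists (linfun G); split.
- apply/eqP; rewrite -subv0; apply/subvP => x.
  rewrite memv_cap memv_ker memv0 GE => /andP[].
  case/memv_addP => _ /vlineP[k ->] [_ /vlineP[m ->] ->].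
  rewrite gpq scaler_eq0 (negPf pqw0) /= => /eqP /rowP km0.
  have := km0 0; have := km0 1; rewrite !mxE /= => -> /eqP.
  by rewrite oppr_eq0 => /eqP ->; rewrite !scale0r addr0.
- by rewrite (lineE _ 1 0) ?oppr0 // scale1r scale0r addr0.
- by rewrite (lineE _ 1 (-1)) ?opprK // scale1r scaleN1r.
- rewrite (lineE _ 0 1) ?scale1r ?scale0r ?add0r //.
  rewrite -[LHS](vline_scale _ (k := -1)) ?oppr_eq0 ?oner_eq0 //.
  by congr (<[_]>)%VS; apply: row2P; rewrite !mxE /=; ring.
- by rewrite (lineE _ 1 (- l)) ?opprK // hvec_vecPQ scale1r scaleNr.
Qed.

(** The images of [p], [q] and [p - q] being known up to scalars, linearity
    forces these scalars to agree up to sign; so any two parametrizations of PQ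
    are proportional. *)
Lemma is_Hpoint_unique l X :
  is_Hpoint <[a]> <[b]> <[c]> <[d]> (Some l) X -> X = <[hvec l a b c d]>%VS.
Proof.
case=> _; rewrite ptP_line ptQ_line ptH_line => Xpq [f [kf fp fh fq fX]].
apply: (limg_inj kf) => //.
  by rewrite hvec_vecPQ -memvE memvB // memvZ.
move: fp fh fq; rewrite fX !limg_line => fp fh fq.
have [k fpE] : exists k : R, f p = k *: \row_(j < 2) nth 0 [:: 0; 1] j.
  by apply/vlineP; have := memv_line (f p); rewrite fp.
have [m fqE] : exists k : R, f q = k *: \row_(j < 2) nth 0 [:: 1; 0] j.
  by apply/vlineP; have := memv_line (f q); rewrite fq.
have [n fhE] : exists k : R, f (p - q) = k *: \row_(j < 2) nth 0 [:: 1; 1] j.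
  by apply/vlineP; have := memv_line (f (p - q)); rewrite fh.
have k0 : k != 0.
  apply/eqP => k0; move: fp; rewrite fpE k0 scale0r.
  move=> /(congr1 (fun U : {vspace _} => \dim U)); rewrite !dim_vline eqxx.
  by case: eqP => // /rowP /(_ 1); rewrite !mxE /= => /eqP; rewrite oner_eq0.
have km : m = - k.
  move: fhE; rewrite linearB /= fpE fqE => /rowP E.
  have := E 0; have := E 1; rewrite !mxE /=; lra.
rewrite hvec_vecPQ -/p -/q linearB linearZ /= fpE fqE km -(vline_scale _ k0).
by congr (<[_]>)%VS; apply: row2P; rewrite !mxE /=; ring.
Qed.

End Defined.

Lemma H_definedP a b c d : H_defined <[a]> <[b]> <[c]> <[d]> <->
  [/\ bracket a b c != 0, bracket b c d != 0 & <[a]>%VS <> <[d]>%VS].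
Proof.
by split=> [/H_defined_bracket//|[abc bcd ad]]; exact: H_definedT.
Qed.

Lemma H_line a b c d l : H_defined <[a]> <[b]> <[c]> <[d]> ->
  H_ <[a]> <[b]> <[c]> <[d]> (Some l) = <[hvec l a b c d]>%VS.
Proof.
move=> /H_definedP[abc bcd ad]; apply: xget_unique.
  exact: is_Hpoint_hvec.
by move=> X; apply: is_Hpoint_unique.
Qed.

Lemma H_undefined (A B C D : subspace3 R) (l : option R) :
  ~ H_defined A B C D -> H_ A B C D l = 0%VS.
Proof. by move=> nd; apply: xgetPN => X [/nd]. Qed.

(** Brackets are multiplied by the determinant of [f], so the construction is
    defined for both quadrangles or for neither; in the latter case both sides
    are the zero subspace. *)
Lemma H_natural (f : 'End('rV[R]_3)) (A B C D : subspace3 R) l :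
  is_projective f -> is_point A -> is_point B -> is_point C -> is_point D ->
  H_ (f @: A)%VS (f @: B)%VS (f @: C)%VS (f @: D)%VS (Some l) =
  (f @: H_ A B C D (Some l))%VS.
Proof.
move=> f_inj /pointE -> /pointE -> /pointE -> /pointE ->.
move: (vpick A) (vpick B) (vpick C) (vpick D) => a b c d {A B C D}.
pose F := lin1_mx f; have fE u : f u = u *m F by rewrite mul_rV_lin1.
have F0 : \det F != 0.
  apply/negP => /det0P[u u0]; rewrite -fE => fu0; case/eqP: u0.
  by apply/eqP; rewrite -memv0 -f_inj memv_ker fu0.
have f_eq U V : (f @: U)%VS = (f @: V)%VS -> U = V.
  by apply: (limg_inj (W := fullv)); rewrite ?subvf // capfv.
have [def|ndef] := pselect (H_defined <[a]> <[b]> <[c]> <[d]>).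
  rewrite (H_line _ def) !limg_line !fE H_line ?hvec_mulmx ?vline_scale //.
  apply/H_definedP; rewrite !bracket_mulmx !mulf_neq0 //.
  - split=> //; rewrite -!fE -!limg_line => /f_eq.
    by case/H_definedP: def.
  - by case/H_definedP: def.
  - by case/H_definedP: def.
rewrite (H_undefined _ ndef) limg0; apply: H_undefined.
rewrite !limg_line !fE => /H_definedP[].
rewrite !bracket_mulmx !mulf_eq0 !negb_or F0 !andbT => abc bcd ad.
apply: ndef; apply/H_definedP; split=> // ad'.
by apply: ad; rewrite -!fE -!limg_line ad'.
Qed.

End Construction.

(** * The image of a pentagon *)

Section Iteration.
Variable R : realType.
Implicit Types (p : polygon R 5) (v : 'I_5 -> 'rV[R]_3) (i j k : 'I_5).
Let phi := golden_ratio R.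

Lemma golden_ratio_gt0 : 0 < phi.
Proof. by rewrite /phi /golden_ratio divr_gt0 // addr_gt0 // sqrtr_gt0. Qed.

Lemma golden_ratio_sqr : phi ^+ 2 = phi + 1.
Proof.
have : Num.sqrt (5 : R) ^+ 2 = 5 by rewrite sqr_sqrtr.
by rewrite /phi /golden_ratio; move: (Num.sqrt 5) => s s2; field: s2.
Qed.

Lemma ordS_cycle i : ordS (ordS (ordS (ordS (ordS i)))) = i.
Proof. by apply/val_inj; case: i => -[|[|[|[|[|]]]]]. Qed.

Lemma ordS_neq i : i != ordS i /\ i != ordS (ordS i).
Proof. by case: i => -[|[|[|[|[|]]]]]. Qed.

Lemma H_iteration_natural l : natural_iteration (@H_iteration R 5 (Some l)).
Proof. by move=> f f_inj p p_point i; apply: H_natural. Qed.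

Definition image_vec v i :=
  hvec phi (v (ordS i)) (v (ordS (ordS i))) (v (ordS (ordS (ordS i))))
    (v (ordS (ordS (ordS (ordS i))))).

(** The weight at vertex [i], for the vertices in cyclic order from [i - 2] to
    [i + 2], written with [ordS] only. *)
Definition weight v i :=
  vertex_weight phi (v (ordS (ordS (ordS i)))) (v (ordS (ordS (ordS (ordS i)))))
    (v i) (v (ordS i)) (v (ordS (ordS i))).

Lemma three_sub_golden_neq0 : 3 - phi != 0.
Proof.
have := golden_ratio_sqr; apply: contra_eq_neq => /subr0_eq <-.
by apply/eqP; lra.
Qed.

Lemma image_vec_consecutive v i :
  bracket (image_vec v i) (image_vec v (ordS i)) (image_vec v (ordS (ordS i))) =
  (3 - phi) *
    (weight v (ordS (ordS (ordS i))) * weight v (ordS (ordS (ordS (ordS i))))).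
Proof.
rewrite /image_vec /weight !ordS_cycle.
exact: bracket_consecutive golden_ratio_sqr.
Qed.

Lemma image_vec_nonconsecutive v i :
  bracket (image_vec v i) (image_vec v (ordS i))
    (image_vec v (ordS (ordS (ordS i)))) =
  phi * (3 - phi) *
    (weight v (ordS (ordS i)) * weight v (ordS (ordS (ordS (ordS i))))).
Proof.
rewrite /image_vec /weight !ordS_cycle.
exact: bracket_nonconsecutive golden_ratio_sqr.
Qed.

(** Three vertices of a pentagon are, up to order, of the form [i], [i + 1],
    [i + 2] or [i], [i + 1], [i + 3]; the two bracket identities settle both. *)
Lemma image_vec_general_position v : (forall i, weight v i != 0) ->
  forall i j k, i != j -> j != k -> i != k ->
  \dim (<[image_vec v i]> + <[image_vec v j]> + <[image_vec v k]>) = 3%N.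
Proof.
move=> k0.
have phi0 : phi != 0 by rewrite gt_eqF // golden_ratio_gt0.
pose S i j k :=
  \dim (<[image_vec v i]> + <[image_vec v j]> + <[image_vec v k]>) = 3%N.
have S1 i : S i (ordS i) (ordS (ordS i)).
  apply/dim_span3; rewrite image_vec_consecutive.
  by rewrite !mulf_neq0 ?three_sub_golden_neq0.
have S2 i : S i (ordS i) (ordS (ordS (ordS i))).
  apply/dim_span3; rewrite image_vec_nonconsecutive.
  by rewrite !mulf_neq0 ?three_sub_golden_neq0.
have Sperm i j k :
    S i j k -> [/\ S j k i, S k i j, S j i k, S i k j & S k j i].
  have SC x y z : S x y z -> S y x z.
    by rewrite /S [(<[image_vec v x]> + _)%VS]addvC.
  have SR x y z : S x y z -> S y z x by rewrite /S -addvA addvC.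
  by move=> Sijk; split; auto.
have ordE i j : [|| j == i, j == ordS i, j == ordS (ordS i),
    j == ordS (ordS (ordS i)) | j == ordS (ordS (ordS (ordS i)))].
  by case: i j => [[|[|[|[|[|//]]]]] ?] [[|[|[|[|[|//]]]]] ?].
move=> i j k ij jk ik; rewrite -/(S i j k).
(* Keeps the search among the 36 facts below purely syntactic. *)
clearbody S.
have S012 := S1 i; have [? ? ? ? ?] := Sperm _ _ _ S012.
have S013 := S2 i; have [? ? ? ? ?] := Sperm _ _ _ S013.
have := S1 (ordS (ordS (ordS (ordS i)))); rewrite ordS_cycle => S401.
have [? ? ? ? ?] := Sperm _ _ _ S401.
have := S2 (ordS (ordS i)); rewrite ordS_cycle => S230.
have [? ? ? ? ?] := Sperm _ _ _ S230.
have := S2 (ordS (ordS (ordS (ordS i)))); rewrite ordS_cycle => S402.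
have [? ? ? ? ?] := Sperm _ _ _ S402.
have := S1 (ordS (ordS (ordS i))); rewrite ordS_cycle => S340.
have [? ? ? ? ?] := Sperm _ _ _ S340.
move: ij jk ik.
by case/or4P: (ordE i j) => [/eqP->|/eqP->|/eqP->|/orP[]/eqP->];
  case/or4P: (ordE i k) => [/eqP->|/eqP->|/eqP->|/orP[]/eqP->];
  rewrite ?eqxx.
Qed.

(** The first and last of four consecutive vertices of a pentagon are adjacent,
    so the condition that they differ follows from a bracket of consecutive
    vertices. *)
Lemma H_iteration_definedP v :
  (forall i, H_defined <[v (ordS i)]> <[v (ordS (ordS i))]>
     <[v (ordS (ordS (ordS i)))]> <[v (ordS (ordS (ordS (ordS i))))]>) <->
  (forall i, bracket (v i) (v (ordS i)) (v (ordS (ordS i))) != 0).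
Proof.
split=> [def i|v0 i].
  have := def (ordS (ordS (ordS (ordS i)))); rewrite ordS_cycle.
  by case/H_definedP.
apply/H_definedP; split; [exact: v0|exact: v0|].
have := v0 (ordS (ordS (ordS (ordS i)))); rewrite ordS_cycle => b0.
by apply: (bracket_neq0_line_neq (w := v i)); rewrite -bracket_cycle.
Qed.

Lemma H_iteration_line v :
  (forall i, bracket (v i) (v (ordS i)) (v (ordS (ordS i))) != 0) ->
  H_iteration (Some phi) (fun i => <[v i]>%VS) = fun i => <[image_vec v i]>%VS.
Proof.
move=> /H_iteration_definedP def; apply/funext => i; exact: H_line (def i).
Qed.

(** The weights at two adjacent vertices divide the bracket of the other three
    images, which is nonzero when the image is in general position. *)
Lemma general_position_H_iterationP v :
  general_position (H_iteration (Some phi) (fun i => <[v i]>%VS)) <->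
  forall i, bracket (v i) (v (ordS i)) (v (ordS (ordS i))) != 0
            /\ weight v i != 0.
Proof.
split=> [T_gen|vP].
  have v0 : forall i, bracket (v i) (v (ordS i)) (v (ordS (ordS i))) != 0.
    apply/H_iteration_definedP => i; apply: contrapT => ndef.
    by have := T_gen.1 i; rewrite /is_point /H_iteration H_undefined // dimv0.
  move=> i; split=> //; move: T_gen; rewrite H_iteration_line // => -[_].
  move=> /(_ (ordS (ordS i)) (ordS (ordS (ordS i)))).
  move=> /(_ (ordS (ordS (ordS (ordS i))))).
  move=> /(_ (ordS_neq _).1 (ordS_neq _).1 (ordS_neq _).2).
  move/dim_span3; rewrite image_vec_consecutive !ordS_cycle.
  by rewrite !mulf_eq0 !negb_or => /and3P[].
rewrite H_iteration_line; last by move=> i; have [] := vP i.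
have gen := @image_vec_general_position v (fun i => (vP i).2); split=> // i.
have [i01 i02] := ordS_neq i; have [i12 _] := ordS_neq (ordS i).
have /dim_span3/bracket_neq0[qi0 _ _] := gen _ _ _ i01 i12 i02.
by rewrite /is_point dim_vline qi0.
Qed.

End Iteration.

(** * Regular pentagons *)

Section Regular.
Variable R : realType.
Let phi := golden_ratio R.

Lemma ord5P (P : 'I_5 -> Prop) : P 0 -> P (ordS 0) -> P (ordS (ordS 0)) ->
  P (ordS (ordS (ordS 0))) -> P (ordS (ordS (ordS (ordS 0)))) -> forall i, P i.
Proof.
move=> P0 P1 P2 P3 P4 [[|[|[|[|[|//]]]]] lt_i5].
- by rewrite (_ : Ordinal _ = 0) //; apply/val_inj.
- by rewrite (_ : Ordinal _ = ordS 0) //; apply/val_inj.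
- by rewrite (_ : Ordinal _ = ordS (ordS 0)) //; apply/val_inj.
- by rewrite (_ : Ordinal _ = ordS (ordS (ordS 0))) //; apply/val_inj.
- by rewrite (_ : Ordinal _ = ordS (ordS (ordS (ordS 0)))) //; apply/val_inj.
Qed.

(** The linear dependencies between vectors whose brackets have the two values
    in the ratio phi; they determine the projective class of the pentagon. *)
Definition pentagon_relations (u : 'I_5 -> 'rV[R]_3) : Prop :=
  [/\ bracket (u 0) (u (ordS 0)) (u (ordS (ordS 0))) != 0,
      u (ordS (ordS (ordS 0))) =
        u 0 - phi *: u (ordS 0) + phi *: u (ordS (ordS 0)) &
      u (ordS (ordS (ordS (ordS 0)))) =
        phi *: u 0 - phi *: u (ordS 0) + u (ordS (ordS 0))].

Let theta : R := 2 * pi / 5.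

Lemma cos_theta_gt0 : 0 < cos theta.
Proof. by apply: cos_gt0_pihalf; rewrite /theta; have := pi_gt0 R; lra. Qed.

Lemma sin_theta_gt0 : 0 < sin theta.
Proof. by apply: sin_gt0_pi; rewrite /theta; have := pi_gt0 R; lra. Qed.

Lemma cos_sin_theta4 :
  cos (theta *+ 4) = cos theta /\ sin (theta *+ 4) = - sin theta.
Proof.
have -> : theta *+ 4 = - theta + pi *+ 2 by rewrite /theta; field.
by rewrite cosD2pi sinD2pi cosN sinN.
Qed.

Lemma cos_sin_theta3 :
  cos (theta *+ 3) = cos (theta *+ 2) /\ sin (theta *+ 3) = - sin (theta *+ 2).
Proof.
have -> : theta *+ 3 = - (theta *+ 2) + pi *+ 2 by rewrite /theta; field.
by rewrite cosD2pi sinD2pi cosN sinN.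
Qed.

Lemma cos_theta_lt1 : cos theta < 1.
Proof.
have := cos2Dsin2 theta; have := sin_theta_gt0; have := cos_theta_gt0.
by move: (cos theta) (sin theta) => u s; nra.
Qed.

(** Since cos (3 theta) = cos (2 theta), the number u = cos theta is a root of
    4 u^3 - 2 u^2 - 3 u + 1 = (u - 1) (4 u^2 + 2 u - 1), and u <> 1; so 2 u + 1
    is the positive root of x^2 = x + 1. *)
Lemma golden_cos_theta : phi = 2 * cos theta + 1.
Proof.
have [] := cos_sin_theta3; rewrite mulrS cosD cos_mulr2n sin_mulr2n => + _.
have := cos2Dsin2 theta; have := cos_theta_lt1; have := cos_theta_gt0.
have := golden_ratio_sqr R; have := golden_ratio_gt0 R; rewrite -/phi.
move: (cos theta) (sin theta) phi => u s f f0 f2 u0 u1 us c3.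
have quad : 4 * u ^+ 2 + 2 * u - 1 = 0.
  have u1' : u - 1 != 0 by rewrite subr_eq0 lt_eqF.
  apply/(mulfI u1').
  have s2 : s ^+ 2 = 1 - u ^+ 2 by rewrite -us; ring.
  have : u * (u ^+ 2 *+ 2 - 1) - (u * s ^+ 2) *+ 2 - (u ^+ 2 *+ 2 - 1) = 0.
    by rewrite -[X in _ - X]c3; ring.
  by rewrite s2 mulr0 => <-; ring.
have : (f - (2 * u + 1)) * (f + 2 * u) = 0.
  have -> : (f - (2 * u + 1)) * (f + 2 * u) =
    f ^+ 2 - f - (4 * u ^+ 2 + 2 * u) by ring.
  by rewrite f2; lra.
move/eqP; rewrite mulf_eq0 => /orP[/eqP|/eqP]; lra.
Qed.

Definition pentagon_vertex (k : 'I_5) : R * R :=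
  (cos (theta *+ k), sin (theta *+ k)).

Lemma pentagon_vertex_regular : regular_polygon pentagon_vertex.
Proof.
exists (0, 0), 1, 0, false; split=> // k; rewrite expr0 mul1r add0r.
have -> : 2 * pi * k%:R / 5%:R = theta *+ k.
  by rewrite /theta -[RHS]mulr_natr; field.
by rewrite /= !mul1r !add0r.
Qed.

Definition pentagon_vec (k : 'I_5) : 'rV[R]_3 :=
  \row_(j < 3) nth 0 [:: (pentagon_vertex k).1; (pentagon_vertex k).2; 1] j.

Lemma pentagon_vec_relations : pentagon_relations pentagon_vec.
Proof.
have [c3 s3] := cos_sin_theta3; have [c4 s4] := cos_sin_theta4.
have c2 := cos_mulr2n theta; have s2 := sin_mulr2n theta.
have u_gt0 := cos_theta_gt0; have u_lt1 := cos_theta_lt1.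
have s_gt0 := sin_theta_gt0.
have uE : cos theta = (phi - 1) / 2 by rewrite golden_cos_theta; field.
have f2 := golden_ratio_sqr R.
rewrite -/phi in f2.
have vE k (n : nat) : nat_of_ord k = n -> pentagon_vec k =
    \row_(j < 3) nth 0 [:: cos (theta *+ n); sin (theta *+ n); 1] j.
  by move=> kn; rewrite /pentagon_vec /pentagon_vertex kn.
split; rewrite (vE 0 0%N) // (vE (ordS 0) 1%N) // (vE (ordS (ordS 0)) 2%N) //
  ?(vE (ordS (ordS (ordS 0))) 3%N) // ?(vE (ordS (ordS (ordS (ordS 0)))) 4%N) //
  mulr0n mulr1n cos0 sin0 c2 s2 ?c3 ?s3 ?c4 ?s4 ?c2 ?s2.
- rewrite /bracket !mxE /=.
  suff : 0 < 2 * sin theta * (1 - cos theta).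
    move=> /gt_eqF/negbT; congr (_ != 0); ring.
  by rewrite !mulr_gt0 // subr_gt0.
- by apply: row3P; rewrite !mxE /= ?uE; field: f2.
- by apply: row3P; rewrite !mxE /= ?uE; field: f2.
Qed.

(** The map is fixed by its values on three independent vectors, and the two
    relations extend the matching to the other two. *)
Lemma projectively_regular_of_relations (u : 'I_5 -> 'rV[R]_3) :
  pentagon_relations u -> projectively_regular (fun i => <[u i]>%VS).
Proof.
move=> [u012 u3 u4]; have [w012 w3 w4] := pentagon_vec_relations.
pose U := rows3 (u 0) (u (ordS 0)) (u (ordS (ordS 0))).
pose W := rows3 (pentagon_vec 0) (pentagon_vec (ordS 0))
  (pentagon_vec (ordS (ordS 0))).
have U_unit : U \in unitmx by rewrite unitmxE unitfE det_rows3.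
have W_unit : W \in unitmx by rewrite unitmxE unitfE det_rows3.
pose F := invmx U *m W.
have UF : U *m F = W by rewrite mulmxA mulmxV // mul1mx.
have rowsE (x y z : 'rV[R]_3) i : row i (rows3 x y z) = nth 0 [:: x; y; z] i.
  by apply/rowP => j; rewrite !mxE.
have uF i : u i *m F = pentagon_vec i.
  have F0 : u 0 *m F = pentagon_vec 0.
    by have := congr1 (row 0) UF; rewrite row_mul !rowsE.
  have F1 : u (ordS 0) *m F = pentagon_vec (ordS 0).
    by have := congr1 (row 1) UF; rewrite row_mul !rowsE.
  have F2 : u (ordS (ordS 0)) *m F = pentagon_vec (ordS (ordS 0)).
    by have := congr1 (row 2) UF; rewrite row_mul !rowsE.
  elim/ord5P: i => //; first rewrite u3 w3; last rewrite u4 w4.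
    by rewrite mulmxDl mulmxBl -!scalemxAl F0 F1 F2.
  by rewrite mulmxDl mulmxBl -!scalemxAl F0 F1 F2.
exists (linfun (mulmxr F)), pentagon_vertex; split.
- apply/eqP; rewrite -subv0; apply/subvP => x.
  rewrite memv_ker memv0 lfunE /= => /eqP xF0.
  have F_unit : F \in unitmx by rewrite unitmx_mul unitmx_inv U_unit.
  by rewrite -[x](mulmxK F_unit) xF0 mul0mx.
- exact: pentagon_vertex_regular.
- by move=> i; rewrite limg_line lfunE /= uF.
Qed.

(** After rescaling, every bracket contains each of the five weights exactly
    once, so the product of the weights is a factor common to all of them. *)
Lemma weighted_image_relations v : (forall i, weight v i != 0) ->
  pentagon_relations (fun i => weight v i *: image_vec v i).
Proof.
move=> k0; pose u i := weight v i *: image_vec v i; rewrite -/u.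
pose C := (3 - phi) *
  (weight v 0 * weight v (ordS 0) * weight v (ordS (ordS 0)) *
   weight v (ordS (ordS (ordS 0))) * weight v (ordS (ordS (ordS (ordS 0))))).
have C0 : C != 0 by rewrite !mulf_neq0 ?three_sub_golden_neq0.
have uE i j k : bracket (u i) (u j) (u k) =
    weight v i * weight v j * weight v k *
    bracket (image_vec v i) (image_vec v j) (image_vec v k).
  by rewrite /u /bracket !mxE; ring.
have CE i : (3 - phi) *
    (weight v i * weight v (ordS i) * weight v (ordS (ordS i)) *
     weight v (ordS (ordS (ordS i))) * weight v (ordS (ordS (ordS (ordS i))))) =
    C.
  by elim/ord5P: i => //; rewrite !ordS_cycle /C; ring.
have S1 i : bracket (u i) (u (ordS i)) (u (ordS (ordS i))) = C.
  by rewrite uE image_vec_consecutive -(CE i) -/phi; ring.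
have S2 i : bracket (u i) (u (ordS i)) (u (ordS (ordS (ordS i)))) = phi * C.
  by rewrite uE image_vec_nonconsecutive -(CE i) -/phi; ring.
have S123 := S1 (ordS 0); have S230 := S2 (ordS (ordS 0)).
have S124 := S2 (ordS 0); have S402 := S2 (ordS (ordS (ordS (ordS 0)))).
have S401 := S1 (ordS (ordS (ordS (ordS 0)))).
rewrite !ordS_cycle in S230 S402 S401.
have B032 : bracket (u 0) (u (ordS (ordS (ordS 0)))) (u (ordS (ordS 0))) =
    - (phi * C) by rewrite bracket_swap -bracket_cycle S230.
have B042 :
    bracket (u 0) (u (ordS (ordS (ordS (ordS 0))))) (u (ordS (ordS 0))) =
    - (phi * C) by rewrite bracket_swap bracket_cycle S402.
split; first by rewrite S1.
  apply: (scalerI C0); rewrite -{1}(S1 0) cramer -bracket_cycle S123 S2 B032.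
  by apply: row3P; rewrite !mxE; ring.
apply: (scalerI C0); rewrite -{1}(S1 0) cramer -bracket_cycle S124 B042.
rewrite bracket_cycle S401.
by apply: row3P; rewrite !mxE; ring.
Qed.

Lemma H_iteration_regular (p : polygon R 5) : (forall i, is_point (p i)) ->
  general_position (H_iteration (Some phi) p) ->
  projectively_regular (H_iteration (Some phi) p).
Proof.
move=> p_point; pose v i := vpick (p i).
have -> : p = fun i => <[v i]>%VS by apply/funext => i; apply: pointE.
move=> /general_position_H_iterationP vP.
rewrite H_iteration_line => [|i]; last by have [] := vP i.
have := projectively_regular_of_relations
  (weighted_image_relations (fun i => (vP i).2)).
congr projectively_regular; apply/funext => i.
by rewrite vline_scale //; have [] := vP i.
Qed.

End Regular.

(** * The domain is open and dense *)

Section Generic.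
Local Open Scope classical_set_scope.
Variable R : realType.

(** Polynomial functions are captured by their closure properties, which is all
    that continuity and the restriction to lines need. *)
Inductive polynomial_fun (m n : nat) : ('M[R]_(m, n) -> R) -> Prop :=
| polynomial_cst c : polynomial_fun (fun _ => c)
| polynomial_coord i j : polynomial_fun (fun M => M i j)
| polynomial_add F G : polynomial_fun F -> polynomial_fun G ->
    polynomial_fun (fun M => F M + G M)
| polynomial_mul F G : polynomial_fun F -> polynomial_fun G ->
    polynomial_fun (fun M => F M * G M).

Lemma polynomial_sub m n (F G : 'M[R]_(m, n) -> R) :
  polynomial_fun F -> polynomial_fun G -> polynomial_fun (fun M => F M - G M).
Proof.
move=> pF pG; have -> : (fun M => F M - G M) = fun M => F M + (- 1) * G M.
  by apply/funext => M; rewrite mulN1r.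
by apply: polynomial_add => //; apply: polynomial_mul => //; constructor.
Qed.

Lemma polynomial_prod m n (I : Type) (r : seq I) (F : I -> 'M[R]_(m, n) -> R) :
  (forall i, polynomial_fun (F i)) ->
  polynomial_fun (fun M => \prod_(i <- r) F i M).
Proof.
move=> pF; elim: r => [|i r IHr].
  rewrite (_ : (fun M => _) = fun=> 1); first by constructor.
  by apply/funext => M; rewrite big_nil.
rewrite (_ : (fun M => _) = fun M => F i M * \prod_(j <- r) F j M).
  exact: polynomial_mul.
by apply/funext => M; rewrite big_cons.
Qed.

Lemma polynomial_continuous m n (F : 'M[R]_(m.+1, n.+1) -> R) :
  polynomial_fun F -> continuous F.
Proof.
elim=> [c|i j|{}F G _ cF _ cG|{}F G _ cF _ cG] M.
- exact: cst_continuous.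
- exact: coord_continuous.
- exact: (continuousD (cF M) (cG M)).
- exact: (continuousM (cF M) (cG M)).
Qed.

Lemma polynomial_on_line m n (F : 'M[R]_(m, n) -> R) (M N : 'M[R]_(m, n)) :
  polynomial_fun F -> exists p : {poly R}, forall t, F (M + t *: N) = p.[t].
Proof.
elim=> [c|i j|{}F G _ [p pE] _ [q qE]|{}F G _ [p pE] _ [q qE]].
- by exists c%:P => t; rewrite hornerC.
- exists ((M i j)%:P + N i j *: 'X) => t.
  by rewrite !mxE hornerD hornerC hornerZ hornerX mulrC.
- by exists (p + q) => t; rewrite hornerD pE qE.
- by exists (p * q) => t; rewrite hornerM pE qE.
Qed.

Lemma open_polynomial_neq0 m n (F : 'M[R]_(m.+1, n.+1) -> R) :
  polynomial_fun F -> open [set M | F M != 0].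
Proof.
move=> /polynomial_continuous cF.
have -> : [set M | F M != 0] = F @^-1` [set x | x != 0] by [].
by apply: open_comp; [move=> *; exact: cF|exact: open_neq].
Qed.

Lemma poly_nonroot_near0 (p : {poly R}) (e : R) : p != 0 -> 0 < e ->
  exists2 t, `|t| < e & p.[t] != 0.
Proof.
move=> p0 e0; apply: contrapT => no.
(* More points of the ball than the polynomial can have roots. *)
pose s := [seq e / i.+2%:R | i <- iota 0 (size p)].
have : (size s < size p)%N.
  apply: max_poly_roots => //.
    apply/allP => _ /mapP[i _ ->]; apply: contrapT => /negP nroot; apply: no.
    exists (e / i.+2%:R) => //; rewrite gtr0_norm ?divr_gt0 //.
    by rewrite ltr_pdivrMr // ltr_pMr // ltr1n.
  rewrite map_inj_uniq ?iota_uniq // => i j /mulfI; rewrite gt_eqF //.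
  by move=> /(_ isT)/invr_inj/eqP; rewrite eqr_nat => /eqP[].
by rewrite size_map size_iota ltnn.
Qed.

(** On the line from [M] to [M0], the function is a polynomial in one variable
    that does not vanish at 1, so it has finitely many zeros and is nonzero at
    points arbitrarily close to [M]. *)
Lemma dense_polynomial_neq0 m n (F : 'M[R]_(m.+1, n.+1) -> R) M0 :
  polynomial_fun F -> F M0 != 0 -> dense [set M | F M != 0].
Proof.
move=> pF F0 O [M OM] O_open.
have [p pE] := polynomial_on_line M (M0 - M) pF.
have p0 : p != 0.
  apply: contra_neq F0 => p0; have := pE 1.
  by rewrite scale1r addrC subrK p0 horner0.
have cvgM : (M + t *: (M0 - M)) @[t --> (0 : R)] --> M.
  rewrite -[X in _ --> X]addr0 -(scale0r (M0 - M)).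
  by apply: cvgD; [exact: cvg_cst|exact: scalel_continuous].
have : \forall t \near (0 : R), O (M + t *: (M0 - M)).
  by apply: cvgM; apply: open_nbhs_nbhs.
case/nbhs_ballP => e /= e0 Oe.
have [t te pt] := poly_nonroot_near0 p0 e0.
exists (M + t *: (M0 - M)); split; last by rewrite /= pE.
by apply: Oe; rewrite /ball /= sub0r normrN.
Qed.

Lemma polynomial_bracket m (i j k : 'I_m) :
  polynomial_fun
    (fun M : 'M[R]_(m, 3) => bracket (row i M) (row j M) (row k M)).
Proof.
rewrite (_ : (fun M => _) = fun M : 'M[R]_(m, 3) =>
  M i 0 * (M j 1 * M k 2 - M j 2 * M k 1)
  - M i 1 * (M j 0 * M k 2 - M j 2 * M k 0)
  + M i 2 * (M j 0 * M k 1 - M j 1 * M k 0)); last first.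
  by apply/funext => M; rewrite /bracket !mxE.
by repeat first [apply: polynomial_coord | apply: polynomial_sub
  | apply: polynomial_mul | apply: polynomial_add].
Qed.

Definition domain_polynomial (M : 'M[R]_(5, 3)) : R :=
  \prod_(i < 5) (bracket (row i M) (row (ordS i) M) (row (ordS (ordS i)) M) *
                 weight (fun j => row j M) i).

Lemma domain_polynomial_fun : polynomial_fun domain_polynomial.
Proof.
apply: polynomial_prod => i; apply: polynomial_mul.
  exact: polynomial_bracket.
rewrite /weight /vertex_weight.
by repeat first [apply: polynomial_bracket | apply: polynomial_cst
  | apply: polynomial_mul | apply: polynomial_add].
Qed.

Lemma domainE :
  [set M : 'M[R]_(5, 3) | general_position
     (H_iteration (Some (golden_ratio R)) (polygon_of_mx M))] =
  [set M | domain_polynomial M != 0].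
Proof.
apply/seteqP; split=> M /=.
  move=> /(general_position_H_iterationP (fun i => row i M)) MP.
  by apply/prodf_neq0 => i _; have [? ?] := MP i; rewrite mulf_neq0.
move=> /prodf_neq0 MP.
apply/(general_position_H_iterationP (fun i => row i M)) => i.
by apply/andP; have := MP i isT; rewrite mulf_eq0 negb_or.
Qed.

(** The relations reduce each bracket to a multiple of the first one; by the
    symmetry of the regular pentagon, the result does not depend on [i]. *)
Lemma pentagon_relations_domain (u : 'I_5 -> 'rV[R]_3) :
  pentagon_relations u -> forall i,
  let b := bracket (u 0) (u (ordS 0)) (u (ordS (ordS 0))) in
  bracket (u i) (u (ordS i)) (u (ordS (ordS i))) = b /\
  weight u i = (3 * golden_ratio R + 1) * b ^+ 2.
Proof.
move=> [_ u3 u4] i b; have f2 := golden_ratio_sqr R.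
rewrite /weight /vertex_weight /b.
elim/ord5P: i; rewrite ?ordS_cycle ?u4 ?u3 /bracket !mxE; split.
- by [].
all: ring: f2.
Qed.

Lemma domain_polynomial_witness : exists M, domain_polynomial M != 0.
Proof.
exists (\matrix_i pentagon_vec R i); apply/prodf_neq0 => i _.
have rel := pentagon_vec_relations R; have := pentagon_relations_domain rel i.
have -> : weight (fun j => row j (\matrix_i pentagon_vec R i)) i =
    weight (pentagon_vec R) i by rewrite /weight !rowK.
rewrite !rowK => -[-> ->]; have [b0 _ _] := rel.
rewrite mulf_neq0 // mulf_neq0 ?expf_neq0 // gt_eqF //.
by have := golden_ratio_gt0 R; lra.
Qed.

Lemma H_iteration_immediately_regularizing :
  immediately_regularizing (@H_iteration R 5 (Some (golden_ratio R))).
Proof.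
have [M0 M0P] := domain_polynomial_witness.
split; last exact: H_iteration_regular.
  by rewrite domainE; apply: open_polynomial_neq0 domain_polynomial_fun.
by rewrite domainE; apply: dense_polynomial_neq0 domain_polynomial_fun M0P.
Qed.

End Generic.

Theorem theorem3 (R : realType) :
  let phi := Some (golden_ratio R) in
  (forall A B C D E : subspace3 R,
     is_point A -> is_point B -> is_point C -> is_point D -> is_point E ->
     let A' := H_ B C D E phi in
     let B' := H_ C D E A phi in
     let C' := H_ D E A B phi in
     let D' := H_ E A B C phi in
     let E' := H_ A B C D phi in
     general_position (tnth [tuple A'; B'; C'; D'; E']) ->
     projectively_regular (tnth [tuple A'; B'; C'; D'; E'])) /\
  natural_iteration (@H_iteration R 5 phi) /\
  immediately_regularizing (@H_iteration R 5 phi).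
Proof.
move=> phi; split; last split.
- move=> A B C D E A1 B1 C1 D1 E1 A' B' C' D' E'.
  have <- : H_iteration phi (tnth [tuple A; B; C; D; E]) =
      tnth [tuple A'; B'; C'; D'; E'].
    apply/funext; elim/ord5P; exact: erefl.
  by apply: H_iteration_regular; elim/ord5P.
- exact: H_iteration_natural.
- exact: H_iteration_immediately_regularizing.
Qed.
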